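(* Let $A\in\mathbb{R}^{n\times n}$ be symmetric, $A\neq 0$, and let $b\in\mathbb{R}^n$, $b\ne0$. If $b\notin\operatorname{range}(A)$, then $\|Ar_{\ell-1}\|=0$, where $r_{\ell-1}=b-Ax_{\ell-1}$, and the MINRES point $x_{\ell-1}$ is a solution of the least-squares problem $\min_x\|Ax-b\|$. However, $x_{\ell-1}$ is not necessarily the minimum-length least-squares solution $x^\dagger$ (i.e., there exist such $A$ and $b$ with $x_{\ell-1}\neq x^\dagger$).
   Context: All norms are 2-norms and exact arithmetic is assumed. $x^\dagger$ denotes the unique solution of $\min\|x\|$ subject to $x\in\arg\min_{x\in\mathbb{R}^n}\|Ax-b\|$. Lanczos process: $v_0=0$, $\beta_1v_1=b$, and for $k=1,2,\dots$: $\alpha_k=v_k^TAv_k$, $\beta_{k+1}v_{k+1}=Av_k-\alpha_kv_k-\beta_kv_{k-1}$, where $\beta_k>0$ is chosen so that $\|v_k\|=1$. The process stops at the first index $k=\ell\le n$ for which $Av_\ell-\alpha_\ell v_\ell-\beta_\ell v_{\ell-1}=0$, and then $\beta_{\ell+1}=0$. Put $V_k=[v_1\ \cdots\ v_k]$ (orthonormal columns). $T_k$ is the symmetric tridiagonal $k\times k$ matrix with diagonal $\alpha_1,\dots,\alpha_k$ and off-diagonal $\beta_2,\dots,\beta_k$. For $k<\ell$, $\underline{T_k}=\begin{bmatrix}T_k\\ \beta_{k+1}e_k^T\end{bmatrix}\in\mathbb{R}^{(k+1)\times k}$, which has full column rank, and $AV_k=V_{k+1}\underline{T_k}$. MINRES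 points: $x_0=0$, and for $1\le k<\ell$, $x_k=V_ky_k$, where $y_k$ is the unique minimizer of $\|\underline{T_k}y-\beta_1e_1\|$ over $y\in\mathbb{R}^k$. Equivalently, $x_k$ minimizes $\|b-Ax\|$ over the Krylov subspace $\mathcal{K}_k(A,b)=\operatorname{span}\{b,Ab,\dots,A^{k-1}b\}$. *)

(* Defs.v *)
From HB Require Import structures.
From mathcomp Require Import all_boot all_order all_algebra.
From mathcomp Require Import boolp classical_sets reals.

Set Implicit Arguments.
Unset Strict Implicit.
Unset Printing Implicit Defensive.

Import Order.TTheory GRing.Theory Num.Theory.
Local Open Scope classical_set_scope.
Local Open Scope ring_scope.

Definition norm2 (R : realType) (m : nat) (x : 'cV[R]_m) : R :=
  Num.sqrt (\sum_(i < m) x i 0 ^+ 2).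

Definition argmin (R : realType) (T : Type) (D : set T) (f : T -> R) : set T :=
  [set x | D x /\ forall z, D z -> f x <= f z].

Definition lssol (R : realType) (m n : nat) (A : 'M[R]_(m, n)) (b : 'cV[R]_m) :
    set 'cV[R]_n :=
  argmin setT (fun x : 'cV[R]_n => norm2 (A *m x - b)).

Definition min_length_lssol (R : realType) (m n : nat) (A : 'M[R]_(m, n))
    (b : 'cV[R]_m) : set 'cV[R]_n :=
  argmin (lssol A b) (@norm2 R n).

Section Lanczos.
Context {R : realType} {n : nat}.
Variables (A : 'M[R]_n) (b : 'cV[R]_n).

Definition rayleigh (v : 'cV[R]_n) : R := (v^T *m A *m v) 0 0.

(* The vector $A v_k - \alpha_k v_k - \beta_k v_{k-1}$, where [u] is $v_{k-1}$,
   [beta] is $\beta_k$ and [v] is $v_k$. *)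
Definition lanczos_step (u : 'cV[R]_n) (beta : R) (v : 'cV[R]_n) : 'cV[R]_n :=
  A *m v - rayleigh v *: v - beta *: u.

(* The triple $(v_k, \beta_{k+1}, v_{k+1})$.  Once a residual vanishes, that is
   for $k \ge \ell$, this gives $\beta_{k+1} = 0$ and $v_{k+1} = 0$. *)
Fixpoint lanczos_state (k : nat) : 'cV[R]_n * R * 'cV[R]_n :=
  let: (v, w) :=
    if k is j.+1 then
      let: (u, beta, v) := lanczos_state j in (v, lanczos_step u beta v)
    else (0, b) in
  (v, norm2 w, (norm2 w)^-1 *: w).

Definition lanczos_v (k : nat) : 'cV[R]_n := (lanczos_state k).1.1.

(* Meaningful for [1 <= k] only. *)
Definition lanczos_beta (k : nat) : R := (lanczos_state k.-1).1.2.

Definition lanczos_alpha (k : nat) : R := rayleigh (lanczos_v k).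

Definition lanczos_residual (k : nat) : 'cV[R]_n :=
  lanczos_step (lanczos_v k.-1) (lanczos_beta k) (lanczos_v k).

(* The first $k$ in $1, \dots, n$ whose residual vanishes ([find] counts
   from 0, whence the successor).  There is always one when [A] is symmetric
   and [b] is nonzero, because the $v_k$ are then orthonormal up to it. *)
Definition lanczos_ell : nat :=
  (find (fun k => lanczos_residual k == 0) (iota 1 n)).+1.

(* Rows and columns are numbered from 0 here, whereas the Lanczos vectors and
   coefficients are numbered from 1. *)
Definition lanczos_V (k : nat) : 'M[R]_(n, k) :=
  \matrix_(i < n, j < k) lanczos_v j.+1 i 0.

Definition lanczos_T (k : nat) : 'M[R]_k :=
  \matrix_(i < k, j < k)
    if i == j then lanczos_alpha i.+1
    else if j == i.+1 :> nat then lanczos_beta j.+1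
    else if i == j.+1 :> nat then lanczos_beta i.+1
    else 0.

Definition lanczos_Tbar (k : nat) : 'M[R]_(k + 1, k) :=
  col_mx (lanczos_T k)
    (lanczos_beta k.+1 *: \row_(j < k) (j.+1 == k)%:R).

Definition minres_rhs (k : nat) : 'cV[R]_(k + 1) :=
  lanczos_beta 1 *: \col_(i < k + 1) (i == 0 :> nat)%:R.

(* The default value of [xget] is never used when $k < \ell$: the matrix
   [lanczos_Tbar k] then has full column rank, so that the minimizer exists
   and is unique. *)
Definition minres_y (k : nat) : 'cV[R]_k :=
  xget 0 (argmin setT
    (fun y : 'cV[R]_k => norm2 (lanczos_Tbar k *m y - minres_rhs k))).

Definition minres_point (k : nat) : 'cV[R]_n :=
  if k is 0 then 0 else lanczos_V k *m minres_y k.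

End Lanczos.

(* Main.v *)
(* Let k + 1 = ell, so that A V_(k+1) = V_(k+1) T with T = T_(k+1) symmetric
   tridiagonal and with nonzero subdiagonal. If T were invertible, b would lie
   in range(A); so T has a nonzero kernel vector, and the last entry of such a
   vector is nonzero because the subdiagonal of T has no zero. Hence the last
   column of T is a combination of the others, and these form Tbar_k. The
   MINRES residual rho = beta_1 e_1 - Tbar_k y is orthogonal to the columns of
   Tbar_k, hence to those of T, so T rho = 0 by symmetry and
   A r = A V_(k+1) rho = V_(k+1) T rho = 0.

   For the second part, let A be the orthogonal projection onto the first axis
   of the plane and b = (1, 1). As ell <= 2, the MINRES point is a multiple
   of b, whereas the minimum-length solution is A b = (1, 0). *)
Require Import Defs.
From HB Require Import structures.
From mathcomp Require Import all_boot all_order all_algebra.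
From mathcomp Require Import boolp classical_sets reals.

Set Implicit Arguments.
Unset Strict Implicit.
Unset Printing Implicit Defensive.

Import Order.TTheory GRing.Theory Num.Theory.
Local Open Scope ring_scope.

(** * Dot product, normal equations and minimum-length solutions *)

Section LeastSquares.
Context {R : realType}.

Definition dot (n : nat) (x y : 'cV[R]_n) : R := (x^T *m y) 0 0.

Lemma dotE n (x y : 'cV[R]_n) : dot x y = \sum_i x i 0 * y i 0.
Proof. by rewrite /dot mxE; apply: eq_bigr => i _; rewrite mxE. Qed.

Lemma dotC n (x y : 'cV[R]_n) : dot x y = dot y x.
Proof. by rewrite !dotE; apply: eq_bigr => i _; rewrite mulrC. Qed.

Lemma dotDr n (x y z : 'cV[R]_n) : dot x (y + z) = dot x y + dot x z.
Proof. by rewrite /dot mulmxDr mxE. Qed.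

Lemma dotZr n (x y : 'cV[R]_n) a : dot x (a *: y) = a * dot x y.
Proof. by rewrite /dot -scalemxAr mxE. Qed.

Lemma dotNr n (x y : 'cV[R]_n) : dot x (- y) = - dot x y.
Proof. by rewrite -scaleN1r dotZr mulN1r. Qed.

Lemma dot0r n (x : 'cV[R]_n) : dot x 0 = 0.
Proof. by rewrite /dot mulmx0 mxE. Qed.

Lemma dot_mulmxl m n (A : 'M[R]_(m, n)) x y : dot (A *m x) y = dot x (A^T *m y).
Proof. by rewrite /dot trmx_mul mulmxA. Qed.

Lemma norm2_ge0 n (x : 'cV[R]_n) : 0 <= norm2 x.
Proof. exact: sqrtr_ge0. Qed.

Lemma norm2_sqr n (x : 'cV[R]_n) : norm2 x ^+ 2 = dot x x.
Proof.
rewrite sqr_sqrtr; last by apply: sumr_ge0 => i _; apply: sqr_ge0.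
by rewrite dotE; apply: eq_bigr => i _; rewrite expr2.
Qed.

Lemma norm2_0 n : norm2 (0 : 'cV[R]_n) = 0.
Proof. by apply/eqP; rewrite -sqrf_eq0 norm2_sqr dot0r. Qed.

Lemma norm2_eq0 n (x : 'cV[R]_n) : (norm2 x == 0) = (x == 0).
Proof.
apply/idP/eqP => [|->]; last by rewrite norm2_0.
rewrite -sqrf_eq0 norm2_sqr dotE psumr_eq0 => [/allP x0|i _]; last first.
  by rewrite -expr2 sqr_ge0.
apply/colP => i; rewrite mxE; apply/eqP.
by rewrite -sqrf_eq0 expr2; exact: x0 (mem_index_enum i).
Qed.

Lemma norm2_normalizeK n (x : 'cV[R]_n) : norm2 x *: ((norm2 x)^-1 *: x) = x.
Proof.
have [->|x0] := eqVneq x 0; first by rewrite !scaler0.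
by rewrite scalerA divff ?scale1r // norm2_eq0.
Qed.

Lemma norm2_le n (x y : 'cV[R]_n) : (norm2 x <= norm2 y) = (dot x x <= dot y y).
Proof. by rewrite -!norm2_sqr ler_sqr ?nnegrE ?norm2_ge0. Qed.

Lemma dot_pythagoras n (x y : 'cV[R]_n) :
  dot x y = 0 -> dot (x + y) (x + y) = dot x x + dot y y.
Proof.
move=> xy0; rewrite dotDr ![dot (x + y) _]dotC !dotDr (dotC y x) xy0.
by rewrite addr0 add0r.
Qed.

(** Column by column: if [A^T A x = 0], then [norm2 (A x) ^+ 2 = dot x (A^T A x) = 0]. *)
Lemma gram_mulmx_eq0 m n p (A : 'M[R]_(m, n)) (B : 'M[R]_(n, p)) :
  A^T *m A *m B = 0 -> A *m B = 0.
Proof.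
move=> AAB0; apply/matrixP => i j; rewrite !mxE.
have /eqP : norm2 (col j (A *m B)) = 0.
  apply/eqP; rewrite -sqrf_eq0 norm2_sqr colE -mulmxA dot_mulmxl !mulmxA AAB0.
  by rewrite mul0mx dot0r.
by rewrite norm2_eq0 => /eqP/colP/(_ i); rewrite !mxE.
Qed.

(** By [gram_mulmx_eq0], the cokernel of [A^T A] is killed by [A], so [A = D A^T A] for some [D];
    transposing shows that [D^T b] is a solution. *)
Lemma normal_equations_solvable m n (A : 'M[R]_(m, n)) (b : 'cV[R]_m) :
  exists x, A^T *m (A *m x - b) = 0.
Proof.
have /submxP[D AE] : (A <= A^T *m A)%MS.
  by rewrite submxE; apply/eqP/gram_mulmx_eq0/mulmx_coker.
exists (D^T *m b).
rewrite mulmxBr {3}AE !trmx_mul trmxK !mulmxA; exact: subrr.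
Qed.

(** If [y] solves the normal equations, [A y - b] is orthogonal to the range of [A] and Pythagoras
    applies. Conversely, comparing a minimizer [x] with such a [y] forces [A x = A y]. *)
Lemma lssolP m n (A : 'M[R]_(m, n)) (b : 'cV[R]_m) (x : 'cV[R]_n) :
  lssol A b x <-> A^T *m (A *m x - b) = 0.
Proof.
have pyth y z : A^T *m (A *m y - b) = 0 ->
    dot (A *m z - b) (A *m z - b)
    = dot (A *m y - b) (A *m y - b) + norm2 (A *m (z - y)) ^+ 2.
  move=> y0; rewrite norm2_sqr -dot_pythagoras.
    by rewrite mulmxBr [_ - b + _]addrC subrKA.
  by rewrite dotC dot_mulmxl y0 dot0r.
split=> [[_ xmin]|x0]; last first.
  by split=> // z _; rewrite norm2_le (pyth x z x0) lerDl sqr_ge0.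
have [y y0] := normal_equations_solvable A b.
have := xmin y I; rewrite norm2_le (pyth y x y0) gerDl => le0.
have /eqP : norm2 (A *m (x - y)) ^+ 2 = 0.
  by apply: le_anti; rewrite le0 sqr_ge0.
rewrite sqrf_eq0 norm2_eq0 mulmxBr subr_eq0 => /eqP ->; exact: y0.
Qed.

Lemma lssol_xget m n (A : 'M[R]_(m, n)) (b : 'cV[R]_m) :
  lssol A b (xget 0 (lssol A b)).
Proof.
have [x /lssolP xsol] := normal_equations_solvable A b.
exact: xgetI xsol.
Qed.

(** Any two least-squares solutions differ by a kernel vector of [A], which is orthogonal to the row
    space; Pythagoras then gives minimality and uniqueness. *)
Lemma min_length_lssol_row_space m n (A : 'M[R]_(m, n)) (b : 'cV[R]_m)
    (w : 'cV[R]_m) :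
  lssol A b (A^T *m w) -> unique (min_length_lssol A b) (A^T *m w).
Proof.
set x := A^T *m w => xsol.
have pyth z : lssol A b z -> dot z z = dot x x + norm2 (z - x) ^+ 2.
  move=> /lssolP z0; have /lssolP x0 := xsol.
  rewrite norm2_sqr -dot_pythagoras; first by rewrite addrC subrK.
  have A0 : A *m (z - x) = 0.
    apply: gram_mulmx_eq0; rewrite -mulmxA.
    have -> : A *m (z - x) = (A *m z - b) - (A *m x - b).
      by rewrite mulmxBr opprB addrA subrK.
    by rewrite mulmxBr z0 x0 subr0.
  by rewrite /x dot_mulmxl trmxK A0 dot0r.
split=> [|z [zsol zmin]].
  by split=> // z zsol; rewrite norm2_le (pyth z zsol) lerDl sqr_ge0.
have := zmin x xsol; rewrite norm2_le (pyth z zsol) gerDl => le0.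
have /eqP : norm2 (z - x) ^+ 2 = 0 by apply: le_anti; rewrite le0 sqr_ge0.
by rewrite sqrf_eq0 norm2_eq0 subr_eq0 => /eqP.
Qed.

End LeastSquares.

(** Back substitution from the last entry, by induction on the distance [d] to it: in row [i+1] of
    [H z = 0], the coefficients before column [i] vanish, and so do the entries of [z] after [i],
    which leaves [H_(i+1,i) z_i = 0]. *)
Lemma hessenberg_ker_last (F : fieldType) m (H : 'M[F]_m) (z : 'cV[F]_m) :
  (forall i j : 'I_m, (j.+1 < i)%N -> H i j = 0) ->
  (forall i j : 'I_m, i = j.+1 :> nat -> H i j != 0) ->
  H *m z = 0 -> (forall i : 'I_m, i.+1 = m -> z i 0 = 0) -> z = 0.
Proof.
move=> H0 Hn0 Hz zlast.
suff z0 d (i : 'I_m) : (m <= i.+1 + d)%N -> z i 0 = 0.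
  by apply/colP => i; rewrite mxE; apply: (z0 m); rewrite leq_addl.
elim: d i => [|d IHd] i.
  by rewrite addn0 => mi; apply: zlast; apply/anti_leq/andP.
case: (ltnP i.+1 m) => [i1m mid|mi _]; last first.
  by apply: zlast; apply/anti_leq/andP.
have := congr1 (fun w : 'cV_m => w (Ordinal i1m) 0) Hz.
rewrite !mxE (bigD1 i) //= big1 => [|j ji]; last first.
  case: (ltnP j i) => [lt_ji|le_ij]; first by rewrite H0 ?mul0r.
  rewrite IHd ?mulr0 // (leq_trans mid) // addnS -addSn leq_add2r.
  by rewrite ltnS ltn_neqAle eq_sym ji.
by move/eqP; rewrite addr0 mulf_eq0 (negPf (Hn0 _ _ _)) //= => /eqP.
Qed.

(** * The Lanczos process: recurrence, orthonormality and termination *)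

Section LanczosProcess.
Context {R : realType} {n : nat}.
Variables (A : 'M[R]_n) (b : 'cV[R]_n).
Local Notation v := (lanczos_v A b).
Local Notation alpha := (lanczos_alpha A b).
Local Notation beta := (lanczos_beta A b).
Local Notation res := (lanczos_residual A b).

Lemma lanczos_v_succ k : v k.+1 = (lanczos_state A b k).2.
Proof. by rewrite /lanczos_v /=; case: (lanczos_state A b k) => [[]]. Qed.

Lemma lanczos_v1 : v 1 = (norm2 b)^-1 *: b. Proof. by []. Qed.

Lemma lanczos_state_succ k : lanczos_state A b k.+1 =
  (v k.+1, norm2 (res k.+1), (norm2 (res k.+1))^-1 *: res k.+1).
Proof.
rewrite /lanczos_residual /lanczos_beta lanczos_v_succ /= /lanczos_v.
by case: (lanczos_state A b k) => [[]].
Qed.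

Lemma lanczos_betaS k : beta k.+2 = norm2 (res k.+1).
Proof. by rewrite {1}/lanczos_beta [k.+2.-1]/= lanczos_state_succ. Qed.

Lemma lanczos_vS k : v k.+2 = (norm2 (res k.+1))^-1 *: res k.+1.
Proof. by rewrite lanczos_v_succ lanczos_state_succ. Qed.

(** This survives a breakdown: a zero residual makes both [beta k.+2] and [v k.+2] zero. *)
Lemma lanczos_recurrence k : A *m v k.+1 =
  beta k.+1 *: v k + alpha k.+1 *: v k.+1 + beta k.+2 *: v k.+2.
Proof.
rewrite lanczos_betaS lanczos_vS norm2_normalizeK.
rewrite /lanczos_residual /lanczos_step.
by rewrite -/(alpha k.+1) [RHS]addrC addrA !subrK.
Qed.

Lemma lanczos_orthonormal m : A^T = A ->
  (forall i, (i < m)%N -> res i.+1 != 0) -> b != 0 ->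
  (forall i j, (i <= m)%N -> (j <= m)%N -> dot (v i.+1) (v j.+1) = (i == j)%:R).
Proof.
move=> symA res_neq0 b0.
have unit_normalize (x : 'cV[R]_n) : x != 0 ->
    dot ((norm2 x)^-1 *: x) ((norm2 x)^-1 *: x) = 1.
  move=> x0; rewrite dotZr dotC dotZr mulrA -norm2_sqr -expr2 -exprMn.
  by rewrite mulVf ?expr1n // norm2_eq0.
elim: m res_neq0 => [_ [] // [] // _ _|m IHm res_neq0].
  by rewrite lanczos_v1 unit_normalize.
have {}IHm := IHm (fun i im => res_neq0 i (leqW im)).
have orth j : (j <= m)%N -> dot (v m.+2) (v j.+1) = 0.
  move=> jm; rewrite lanczos_vS dotC dotZr.
  suff -> : dot (v j.+1) (res m.+1) = 0 by rewrite mulr0.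
  have dot_pred : dot (v j.+1) (v m) = (j.+1 == m)%:R.
    (* For [m = 0] the vector [v 0] is zero by convention. *)
    case: m jm {res_neq0} IHm => [|m'] jm IHm; first by rewrite dot0r.
    by rewrite IHm ?leqnSn // eqSS.
  rewrite /lanczos_residual /lanczos_step !(dotDr, dotNr, dotZr) /= dot_pred.
  move: jm; rewrite leq_eqVlt => /predU1P[jm|jm].
    (* Case [j = m]: the Rayleigh quotient is exactly the component removed. *)
    rewrite jm in dot_pred *.
    by rewrite IHm // eqxx gtn_eqF // mulr0 mulr1 subr0 /rayleigh -mulmxA subrr.
  rewrite (IHm j m) ?(ltnW jm) // (ltn_eqF jm) mulr0 subr0.
  (* Case [j < m]: symmetry moves [A] onto [v j.+1], whose recurrence reaches only up to
     [v j.+2]. *)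
  have -> : dot (v j.+1) (A *m v m.+1) = dot (A *m v j.+1) (v m.+1).
    by rewrite dot_mulmxl symA.
  rewrite lanczos_recurrence dotC !(dotDr, dotZr).
  rewrite (IHm m j.+1) // (IHm m j) ?(ltnW jm) // (gtn_eqF jm) mulr0 addr0.
  have -> : dot (v m.+1) (v j) = 0.
    case: j jm {dot_pred} => [|j] jm; first by rewrite dot0r.
    by rewrite IHm ?gtn_eqF // ltnW // ltnW.
  (* The surviving [beta] term occurs only for [j.+1 = m], where the subtracted multiple of [v m]
     cancels it. *)
  rewrite mulr0 add0r eq_sym; case: eqP => [->|_]; first by rewrite subrr.
  by rewrite !mulr0 subr0.
move=> i j; rewrite leq_eqVlt => /predU1P[->|im];
  rewrite leq_eqVlt => /predU1P[->|jm].
- by rewrite eqxx lanczos_vS unit_normalize ?res_neq0.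
- by rewrite orth // gtn_eqF.
- by rewrite dotC orth // ltn_eqF.
- exact: IHm.
Qed.

(** Otherwise [v 1], ..., [v n.+1] would be orthonormal in dimension [n], against the rank bound. *)
Lemma lanczos_stops : A^T = A -> b != 0 -> has (fun k => res k == 0) (iota 1 n).
Proof.
move=> symA b0; apply: contraT => /hasPn nstop.
have gram : (lanczos_V A b n.+1)^T *m lanczos_V A b n.+1 = 1%:M.
  apply/matrixP => i j; rewrite !mxE.
  transitivity (dot (v i.+1) (v j.+1)).
    by rewrite dotE; apply: eq_bigr => k _; rewrite !mxE.
  rewrite (@lanczos_orthonormal n) ?(leq_ord i) ?(leq_ord j) // => k kn.
  by apply: nstop; rewrite mem_iota.
have := mxrank1 R n.+1; rewrite -gram => rkE.
set V := lanczos_V A b n.+1 in rkE.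
have := leq_trans (mxrankM_maxr V^T V) (rank_leq_row V).
by rewrite rkE ltnn.
Qed.

Lemma lanczos_ell_le : A^T = A -> b != 0 -> (lanczos_ell A b <= n)%N.
Proof.
by move=> symA b0; rewrite -[leqRHS](size_iota 1 n) -has_find lanczos_stops.
Qed.

Lemma lanczos_residual_ell : A^T = A -> b != 0 -> res (lanczos_ell A b) = 0.
Proof.
move=> symA b0; have := nth_find 0%N (lanczos_stops symA b0).
by rewrite nth_iota ?add1n; [move/eqP | exact: lanczos_ell_le].
Qed.

Lemma lanczos_residual_lt_ell k : A^T = A -> b != 0 ->
  (k.+1 < lanczos_ell A b)%N -> res k.+1 != 0.
Proof.
move=> symA b0 kl.
have := @before_find _ 0%N (fun k => res k == 0) (iota 1 n) k kl.
rewrite nth_iota ?add1n => [->//|].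
by rewrite (leq_trans _ (lanczos_ell_le symA b0)) // ltnW.
Qed.

(** * The tridiagonal matrix and the relation [A V = V T] *)

Lemma lanczos_T_entry k (i j : 'I_k) : lanczos_T A b k i j =
  (i == j :> nat)%:R * alpha j.+1 + (i.+1 == j)%:R * beta j.+1
  + (i == j.+1 :> nat)%:R * beta j.+2.
Proof.
rewrite mxE -val_eqE /=; have [->|ij] := eqVneq (i : nat) j.
  by rewrite gtn_eqF // ltn_eqF // !mul0r !addr0 mul1r.
rewrite (eq_sym (j : nat)); have [<-|] := eqVneq i.+1 j.
  by rewrite ltn_eqF // !mul0r addr0 add0r mul1r.
have [->|] := eqVneq (i : nat) j.+1; first by rewrite !mul0r !add0r mul1r.
by rewrite !mul0r !addr0.
Qed.

Lemma lanczos_T_sym k : (lanczos_T A b k)^T = lanczos_T A b k.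
Proof.
apply/matrixP => i j; rewrite mxE !mxE -!val_eqE /=.
rewrite (eq_sym (j : nat)); case: eqVneq => [->//|_].
by case: eqVneq => [->|_]; [rewrite ltn_eqF | case: eqVneq].
Qed.

Lemma lanczos_T_last_col k : exists c : 'cV[R]_(k + 1),
  lanczos_T A b (k + 1) = row_mx (lanczos_Tbar A b k) c.
Proof.
exists (rsubmx (lanczos_T A b (k + 1))); rewrite -[LHS]hsubmxK; congr row_mx.
apply/matrixP => i j; rewrite mxE lanczos_T_entry /lanczos_Tbar mxE.
case: split_ordP => i' -> /=; first by rewrite lanczos_T_entry.
rewrite ord1 !mxE addn0 /= (gtn_eqF (ltn_ord j)).
rewrite (gtn_eqF (leqW (ltn_ord j))).
by rewrite !mul0r !add0r mulrC eq_sym; case: eqP => [->|_] //; rewrite !mulr0.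
Qed.

Lemma lanczos_V_mul k (y : 'cV[R]_k) :
  lanczos_V A b k *m y = \sum_i y i 0 *: v i.+1.
Proof.
apply/colP => i; rewrite !mxE summxE; apply: eq_bigr => j _.
by rewrite !mxE mulrC.
Qed.

Lemma lanczos_AV k : res k = 0 ->
  A *m lanczos_V A b k = lanczos_V A b k *m lanczos_T A b k.
Proof.
case: k => [|k] resk; first by apply/matrixP => i [].
have pick (F : nat -> 'cV[R]_n) p :
    \sum_(i < k.+1) (i == p :> nat)%:R *: F i = (p < k.+1)%:R *: F p.
  case: (ltnP p k.+1) => [pk|kp]; last first.
    rewrite scale0r big1 // => i _.
    by rewrite ltn_eqF ?scale0r // (leq_trans _ kp).
  rewrite (bigD1 (Ordinal pk)) //= eqxx big1 ?addr0 // => i ip.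
  by rewrite [_ == p](negPf ip) scale0r.
have colE' (M : 'M[R]_(n, k.+1)) i j : M i j = col j M i 0 by rewrite mxE.
have colM p q r (M : 'M[R]_(p, q)) (N : 'M[R]_(q, r)) j :
    col j (M *m N) = M *m col j N.
  by rewrite !colE mulmxA.
apply/matrixP => i j; rewrite !colE' !colM; congr (_ i 0).
have -> : col j (lanczos_V A b k.+1) = v j.+1 by apply/colP => p; rewrite !mxE.
rewrite lanczos_recurrence lanczos_V_mul.
(* The indicator form of the entries splits the column into the three terms of the recurrence, each
   evaluated by [pick]. *)
under eq_bigr => p _ do rewrite mxE lanczos_T_entry !scalerDl -!scalerA.
rewrite !big_split /= (pick (fun p => alpha j.+1 *: v p.+1)) ltn_ord scale1r.
rewrite (pick (fun p => beta j.+2 *: v p.+1)).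
have -> : \sum_(i < k.+1) (i.+1 == j :> nat)%:R *: (beta j.+1 *: v i.+1)
    = beta j.+1 *: v j.
  case: (j : nat) (ltn_ord j) => [|p] pk.
    by rewrite big1 ?scaler0 // => i' _; rewrite scale0r.
  under eq_bigr do rewrite eqSS.
  by rewrite (pick (fun i => beta p.+2 *: v i.+1)) ltnW // scale1r.
(* In the last column the indicator is 0, but there [beta j.+2] is the norm of the vanishing
   residual. *)
have -> : (j.+1 < k.+1)%:R *: (beta j.+2 *: v j.+2) = beta j.+2 *: v j.+2.
  have [->|jk] := eqVneq (j : nat) k.
    by rewrite lanczos_betaS resk norm2_0 scale0r scaler0.
  by rewrite ltnS ltn_neqAle jk -ltnS ltn_ord scale1r.
by rewrite [beta _ *: _ + _]addrC.
Qed.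

(** * The MINRES points *)

Lemma minres_rhsE k : lanczos_V A b (k + 1) *m minres_rhs A b k = b.
Proof.
have k0 : (0 < k + 1)%N by rewrite addn1.
rewrite lanczos_V_mul (bigD1 (Ordinal k0)) //= big1 => [|i i0]; last first.
  by rewrite !mxE [_ == 0%N](negPf i0) mulr0 scale0r.
by rewrite addr0 !mxE eqxx mulr1 norm2_normalizeK.
Qed.

Lemma minres_point_colinear k :
  (k <= 1)%N -> exists c, minres_point A b k = c *: b.
Proof.
case: k => [|[|//]] _; first by exists 0; rewrite scale0r.
exists (minres_y A b 1 0 0 * (norm2 b)^-1).
by rewrite -scalerA -lanczos_v1 /= lanczos_V_mul big_ord1.
Qed.

(** For [k = 0], which occurs when the process stops at once, the product is empty. *)
Lemma minres_pointE k : minres_point A b k = lanczos_V A b k *m minres_y A b k.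
Proof.
by case: k => //=; rewrite lanczos_V_mul big_ord0.
Qed.

Lemma minres_ell_normal_equations : A^T = A -> b != 0 ->
  ~ (exists x : 'cV[R]_n, A *m x = b) ->
  A *m (b - A *m minres_point A b (lanczos_ell A b).-1) = 0.
Proof.
move=> symA b0 b_range.
set k := (lanczos_ell A b).-1.
have ellE : lanczos_ell A b = (k + 1)%N by rewrite addn1.
have AV : A *m lanczos_V A b (k + 1)
    = lanczos_V A b (k + 1) *m lanczos_T A b (k + 1).
  by apply: lanczos_AV; rewrite -ellE lanczos_residual_ell.
have [c TE] := lanczos_T_last_col k.
set T := lanczos_T A b (k + 1) in AV TE; set B := lanczos_Tbar A b k in TE.
have symT : T^T = T by apply: lanczos_T_sym.
pose rho := minres_rhs A b k - B *m minres_y A b k.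
(* [minres_y] is by definition the [xget] choice in [lssol B (minres_rhs A b k)]. *)
have Brho : B^T *m rho = 0.
  rewrite -[RHS]oppr0 -(proj1 (lssolP _ _ _) (lssol_xget B (minres_rhs A b k))).
  by rewrite -mulmxN opprB.
have resE : b - A *m minres_point A b k = lanczos_V A b (k + 1) *m rho.
  rewrite mulmxBr minres_rhsE minres_pointE; congr (_ - _).
  rewrite !mulmxA; congr (_ *m _).
  have VE : lanczos_V A b (k + 1) = row_mx (lanczos_V A b k) (v k.+1).
    rewrite -[LHS]hsubmxK; congr row_mx; apply/matrixP => i j; rewrite !mxE //=.
    by rewrite ord1 addn0.
  (* The first [k] columns of [AV] read [A V_k = V_(k+1) B]. *)
  move: AV; rewrite {1}VE TE !mul_mx_row => /eq_row_mx[-> _] //.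
suff Trho : T *m rho = 0 by rewrite resE mulmxA AV -mulmxA Trho mulmx0.
have [Tunit|Tsing] := boolP (T \in unitmx).
  case: b_range.
  exists (lanczos_V A b (k + 1) *m (invmx T *m minres_rhs A b k)).
  by rewrite mulmxA AV -mulmxA mulKVmx // minres_rhsE.
have [z z0 Tz] : exists2 z : 'cV[R]_(k + 1), z != 0 & T *m z = 0.
  move: Tsing; rewrite -row_free_unit -kermx_eq0 =>
    /rowV0Pn[u /sub_kermxP uT u0].
  exists u^T; first by rewrite -trmx0 (inj_eq trmx_inj).
  by rewrite -symT -trmx_mul uT trmx0.
have zlast0 : dsubmx z != 0.
  apply: contra_neq z0 => zlast.
  apply: (@hessenberg_ker_last _ _ T) => //.
  - move=> i j ji; rewrite lanczos_T_entry !gtn_eqF ?mul0r ?addr0 //.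
      exact: ltn_trans (leqW ji).
    exact: ltnW.
  - move=> i j ij; rewrite lanczos_T_entry ij eqxx !gtn_eqF //.
    rewrite !mul0r !add0r mul1r lanczos_betaS norm2_eq0.
    rewrite lanczos_residual_lt_ell // ellE.
    by rewrite -ij.
  - move=> i ik.
    have -> : i = rshift k 0.
      by apply/val_inj/succn_inj; rewrite /= ik addn0 addn1.
    by have /colP/(_ 0) := zlast; rewrite !mxE.
(* [T z = 0] reads [B z' + c z_last = 0], where [z_last] is nonzero. *)
have cE : c = B *m (- (dsubmx z 0 0)^-1 *: usubmx z).
  have zl : dsubmx z 0 0 != 0.
    by apply: contra_neq zlast0 => zl; apply/colP => i; rewrite ord1 zl mxE.
  move: Tz; rewrite TE -{1}(vsubmxK z) mul_row_col => /eqP.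
  rewrite addrC addr_eq0 => /eqP cz.
  rewrite -scalemxAr scaleNr -scalerN -cz.
  by rewrite {2}[dsubmx z]mx11_scalar mul_mx_scalar scalerA mulVf ?scale1r.
(* [T rho = T^T rho] stacks [B^T rho] over [c^T rho], and [c] lies in the range of [B]. *)
rewrite -symT TE tr_row_mx mul_col_mx Brho cE trmx_mul -mulmxA Brho mulmx0.
by rewrite col_mx0.
Qed.

End LanczosProcess.

Theorem theorem3p2 (R : realType) :
  (forall (n : nat) (A : 'M[R]_n) (b : 'cV[R]_n),
     A^T = A -> A != 0 -> b != 0 ->
     ~ (exists x : 'cV[R]_n, A *m x = b) ->
     let x := minres_point A b (lanczos_ell A b).-1 in
     norm2 (A *m (b - A *m x)) = 0 /\ lssol A b x)
  /\
  (exists (n : nat) (A : 'M[R]_n) (b : 'cV[R]_n),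
     [/\ A^T = A, A != 0, b != 0,
         ~ (exists x : 'cV[R]_n, A *m x = b)
       & exists xdag : 'cV[R]_n,
           unique (min_length_lssol A b) xdag /\
           minres_point A b (lanczos_ell A b).-1 <> xdag]).
Proof.
split=> [n A b symA _ b0 b_range x|].
  have Ar : A *m (b - A *m x) = 0 by apply: minres_ell_normal_equations.
  split; first by rewrite Ar norm2_0.
  by apply/lssolP; rewrite symA -opprB mulmxN Ar oppr0.
pose A : 'M[R]_2 := delta_mx 0 0; pose b : 'cV[R]_2 := const_mx 1.
have symA : A^T = A by rewrite trmx_delta.
have b0 : b != 0.
  by apply/eqP => /colP/(_ 0); rewrite !mxE; apply/eqP/oner_neq0.
have AE (x : 'cV[R]_2) i : (A *m x) i 0 = (i == 0)%:R * x 0 0.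
  rewrite mxE (bigD1 0) //= big1 ?addr0 ?mxE ?eqxx ?andbT // => j j0.
  by rewrite mxE (negPf j0) andbF mul0r.
exists 2%N, A, b; split=> //.
- by apply/eqP => /matrixP/(_ 0 0); rewrite !mxE; apply/eqP/oner_neq0.
- by case=> x /colP/(_ 1); rewrite AE mxE mul0r => /esym/eqP; rewrite oner_eq0.
(* The form [A^T w] puts this point in the row space; it solves the normal equations because [A] is
   a symmetric idempotent. *)
exists (A^T *m b); split.
  apply: min_length_lssol_row_space; apply/lssolP.
  by rewrite symA mulmxBr !mulmxA !mul_delta_mx subrr.
have ell2 : ((lanczos_ell A b).-1 <= 1)%N by rewrite -ltnS lanczos_ell_le.
have [c ->] := minres_point_colinear A b ell2.
(* The second coordinate of [c *: b = A *m b] gives [c = 0], the first [c = 1]. *)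
rewrite symA => /colP cb; have := cb 0; have := cb 1.
by rewrite !AE !mxE mul0r !mulr1 => -> /esym/eqP; rewrite oner_eq0.
Qed.
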